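(* Let $\alpha\in(0,1]$, let $\nu,\beta,\gamma\in\mathbb{R}$ satisfy $16\nu-4\beta+\gamma=0$, and suppose $\mu:=2(\nu-\beta+\gamma)\neq 0$. Let $C\in\mathbb{R}$ and $\bar\mu:=C\mu$. Then the function $$u(x,t)=C+E_{2\alpha,1}\left(-\bar\mu^2t^{2\alpha}\right)\cos x-\bar\mu\,t^{\alpha}E_{2\alpha,\alpha+1}\left(-\bar\mu^2t^{2\alpha}\right)\sin x$$ satisfies, for all $x\in\mathbb{R}$ and $t>0$, the fifth order nonlinear time-fractional dispersive equation $$\frac{\partial^\alpha u}{\partial t^\alpha}=\nu\frac{\partial^5 (u^2)}{\partial x^5}+\beta\frac{\partial^3 (u^2)}{\partial x^3}+\gamma\frac{\partial (u^2)}{\partial x}.$$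
   Context: For $0<\alpha<1$, $\partial^\alpha/\partial t^\alpha$ is the Caputo fractional derivative in $t$ (with $x$ fixed), $$\frac{d^\alpha f}{dt^\alpha}(t)=\frac{1}{\Gamma(1-\alpha)}\int_0^t (t-\tau)^{-\alpha}f'(\tau)\,d\tau,$$ for $f$ absolutely continuous on compact intervals $[0,T]$; for $\alpha=1$ it is the ordinary derivative $d/dt$. For $a>0$, $b>0$, the two-parameter Mittag-Leffler function is $E_{a,b}(z)=\sum_{k=0}^\infty \frac{z^k}{\Gamma(ak+b)}$. *)

(* Defs.v *)
From HB Require Import structures.
From mathcomp Require Import all_boot all_order all_algebra.
From mathcomp Require Import all_classical all_reals all_analysis.

Set Implicit Arguments.
Unset Strict Implicit.
Unset Printing Implicit Defensive.

Import Order.TTheory GRing.Theory Num.Theory.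
Import numFieldNormedType.Exports.

Local Open Scope classical_set_scope.
Local Open Scope ring_scope.

(* Euler's integral; it converges for 0 < s, and is only used for such s. *)
Definition Gamma (R : realType) (s : R) : R :=
  \int[@lebesgue_measure R]_(x in `]0, +oo[) (x `^ (s - 1) * expR (- x)).

(* E_{a,b}(z), for 0 < a and 0 < b. *)
Definition mittag_leffler (R : realType) (a b z : R) : R :=
  limn (series (fun k : nat => z ^+ k / Gamma (a * k%:R + b))).

(* The intervals (l i, r i), i < n, are pairwise disjoint subintervals
   of [a, b]. *)
Definition abs_continuous (R : realType) (a b : R) (f : R -> R) : Prop :=
  forall e : R, 0 < e -> exists2 d : R, 0 < d &
    forall (n : nat) (l r : 'I_n -> R),
      (forall i, a <= l i /\ l i <= r i /\ r i <= b) ->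
      (forall i j, i != j -> r i <= l j \/ r j <= l i) ->
      \sum_(i < n) (r i - l i) < d ->
      \sum_(i < n) `|f (r i) - f (l i)| < e.

(* f^`() is a total function; for an absolutely continuous f it is the genuine
   derivative almost everywhere, which is all that the integral sees. *)
Definition caputo_integrand (R : realType) (alpha : R) (f : R -> R) (t : R)
  : R -> R := fun tau => (t - tau) `^ (- alpha) * f^`()%classic tau.

Definition caputo (R : realType) (alpha : R) (f : R -> R) (t : R) : R :=
  (Gamma (1 - alpha))^-1 *
  \int[@lebesgue_measure R]_(tau in `[0, t]) caputo_integrand alpha f t tau.

(* Derivative of order alpha, for 0 < alpha <= 1. *)
Definition frac_derive (R : realType) (alpha : R) (f : R -> R) (t : R) : R :=
  if alpha == 1 then f^`()%classic t else caputo alpha f t.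

(* The conditions under which the value frac_derive alpha f t is meaningful. *)
Definition frac_derivable (R : realType) (alpha : R) (f : R -> R) (t : R)
  : Prop :=
  if alpha == 1 then derivable f t 1
  else (forall T : R, 0 < T -> abs_continuous 0 T f) /\
       (@lebesgue_measure R).-integrable `[0, t]
         (EFin \o caputo_integrand alpha f t).

Definition n_derivable (R : realType) (n : nat) (f : R -> R) (x : R) : Prop :=
  forall k : nat, (k < n)%N -> derivable f^`(k)%classic x 1.

(* The equation at the point (x, t), for u : space -> time -> R: all the
   derivatives in it exist, and the two sides agree. *)
Definition satisfies_dispersive_eq (R : realType) (alpha nu beta gamma : R)
    (u : R -> R -> R) (x t : R) : Prop :=
  [/\ frac_derivable alpha (fun s => u x s) t,
      n_derivable 5 (fun y => u y t ^+ 2) x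
    & frac_derive alpha (fun s => u x s) t =
        nu * (fun y => u y t ^+ 2)^`(5)%classic x
        + beta * (fun y => u y t ^+ 2)^`(3)%classic x
        + gamma * (fun y => u y t ^+ 2)^`()%classic x].

(* Main.v *)
Require Import Defs.
From HB Require Import structures.
From mathcomp Require Import all_boot all_order all_algebra.
From mathcomp Require Import all_classical all_reals all_analysis.
From mathcomp Require Import measurable_realfun ring lra.
Import Order.TTheory GRing.Theory Num.Theory.
Import numFieldNormedType.Exports.
Local Open Scope classical_set_scope.
Local Open Scope ring_scope.

(* For fixed x, u(x, t) = C + sum_n w_n t^(n alpha) / Gamma(n alpha + 1), where
   (w_n) interleaves the coefficients of the two Mittag-Leffler functions.  The
   Beta integral gives D^alpha t^p = Gamma(p+1) / Gamma(p+1-alpha) t^(p-alpha),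
   so D^alpha shifts (w_n) by one.  The series is g(t^alpha) with g entire, and
   |g'| is bounded on compact sets, so on (0, t) the Caputo integrand is dominated
   by a multiple of (t-tau)^(-alpha) tau^(alpha-1): this gives integrability and
   termwise integration.  The shift acts on w_n as mubar d/dx, which yields
   D^alpha u = mubar du/dx; on the other side u^2 contains only the frequencies
   0, 1, 2, the operator in x annihilates frequency 2 since
   16 nu - 4 beta + gamma = 0, and it multiplies the frequency 1 part 2C(u - C)
   by nu - beta + gamma after one differentiation. *)

(** * Affine substitution and Euler's integrals *)

Lemma measurable_affine {R : realType} (c d : R) :
  measurable_fun [set: R] (fun x : R => c * x + d).
Proof. by apply: measurable_funD => //; apply: measurable_funM. Qed.

(** The image of Lebesgue measure under x -> c x + d, multiplied by c, gives each interval ]a, b]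
    its length b - a, so it is Lebesgue measure by uniqueness. *)
Lemma ge0_integral_affine {R : realType} (c d : R) (f : R -> \bar R) :
  0 < c -> measurable_fun [set: R] f -> (forall x, 0 <= f x)%E ->
  (\int[@lebesgue_measure R]_x f x =
   c%:E * \int[@lebesgue_measure R]_x f (c * x + d)%R)%E.
Proof.
move=> c0 mf f0.
pose phi : measurableTypeR R -> measurableTypeR R := fun x => c * x + d.
have mphi : measurable_fun setT phi by exact: measurable_affine.
have cge0 := ltW c0.
pose pf : {measure set (measurableTypeR R) -> \bar R} :=
  measure_function_pushforward__canonical__measure_function_Measure
    (@lebesgue_measure R) mphi.
pose nu := mscale (NngNum cge0) pf.
transitivity (\int[nu]_x f x)%E; last first.
  by rewrite ge0_integral_mscale// ge0_integral_pushforward.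
apply: eq_measure_integral => A mA _.
move: A mA; apply: (@lebesgue_measure_unique R nu) => /= _ [[a b]] _ <-.
rewrite /nu /mscale /= /pushforward.
rewrite (_ : phi @^-1` _ = `](a - d) / c, (b - d) / c]%classic); last first.
  apply/seteqP; split => x /=; rewrite /phi !in_itv/= ltr_pdivrMr// ler_pdivlMr//;
    rewrite ltrBlDr lerBrDr [c * x]mulrC//.
rewrite !lebesgue_measure_itv/= !lte_fin ltr_pM2r ?invr_gt0// ltrD2r.
case: ifPn => ab; last by rewrite mule0.
rewrite -!EFinD -EFinM; congr EFin; rewrite -mulrBl opprB addrA subrK mulrC.
by rewrite mulfVK// gt_eqF.
Qed.

(** The truncated power x_+^(s-1), with the exponent normalised as in Euler's integrals. Since it
    vanishes off (0, +oo), all integrals run over the whole line, and translations and Tonelli need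
    no change of domain. *)
Definition powR_pos {R : realType} (s x : R) : R :=
  if 0 < x then x `^ (s - 1) else 0.

Lemma powR_pos_ge0 {R : realType} (s x : R) : 0 <= powR_pos s x.
Proof. by rewrite /powR_pos; case: ifP => // _; exact: powR_ge0. Qed.

Lemma measurable_powR_pos {R : realType} (s : R) :
  measurable_fun [set: R] (powR_pos s).
Proof.
apply: measurable_fun_ifT => //.
- exact: measurable_fun_ltr.
Qed.

(* Extended-real versions of Euler's two integrals, with the integrands cut off
   to 0 outside (0, +oo), respectively (0, t). *)
Definition egamma {R : realType} (s : R) : \bar R :=
  (\int[@lebesgue_measure R]_x (powR_pos s x * expR (- x))%:E)%E.

Definition ebeta {R : realType} (a b t : R) : \bar R :=
  (\int[@lebesgue_measure R]_x (powR_pos a x * powR_pos b (t - x))%:E)%E.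

Lemma egammaE {R : realType} (s : R) : Gamma s = fine (egamma s).
Proof.
rewrite /Gamma /egamma /Rintegral; congr fine.
rewrite integral_mkcond; apply: eq_integral => x _.
rewrite /powR_pos patchE /=.
case: ifPn => [|]; first by rewrite inE/= in_itv/= andbT => ->.
rewrite notin_setE/= in_itv/= andbT => /negP/negbTE ->.
by rewrite mul0r.
Qed.

Lemma egamma_ge0 {R : realType} (s : R) : (0 <= egamma s)%E.
Proof.
by apply: integral_ge0 => x _; rewrite lee_fin mulr_ge0 ?powR_pos_ge0 ?expR_ge0.
Qed.

Lemma ebeta_ge0 {R : realType} (a b t : R) : (0 <= ebeta a b t)%E.
Proof.
by apply: integral_ge0 => x _; rewrite lee_fin mulr_ge0 ?powR_pos_ge0.
Qed.

Lemma measurable_ebeta_integrand {R : realType} (a b t : R) :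
  measurable_fun [set: R] (fun x : R => powR_pos a x * powR_pos b (t - x)).
Proof.
apply: measurable_funM; first exact: measurable_powR_pos.
apply: measurableT_comp; first exact: measurable_powR_pos.
exact: measurable_funB.
Qed.

Lemma measurable_egamma_integrand {R : realType} (s : R) :
  measurable_fun [set: R] (fun x : R => powR_pos s x * expR (- x)).
Proof.
apply: measurable_funM; first exact: measurable_powR_pos.
by apply: measurableT_comp => //; apply: measurableT_comp.
Qed.

(** Substitute x -> t x: the integrand is homogeneous of degree a + b - 2 and the Jacobian adds one
    more factor t. For t <= 0 both sides vanish, as no x satisfies 0 < x < t. *)
Lemma ebeta_scale {R : realType} (a b t : R) :
  ebeta a b t = ((powR_pos (a + b) t)%:E * ebeta a b 1)%E.
Proof.
have [t0|t0] := ltP 0 t; last first.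
  rewrite /powR_pos ltNge t0/= mul0e /ebeta integral0_eq// => x _.
  rewrite /powR_pos; case: (ltP 0 x) => x0; last by rewrite mul0r.
  rewrite (_ : 0 < t - x = false) ?mulr0//; lra.
pose h (x : R) := (powR_pos a x * powR_pos b (t - x))%:E.
have mh : measurable_fun [set: R] h.
  by apply/measurable_EFinP; exact: measurable_ebeta_integrand.
have h0 x : (0 <= h x)%E by rewrite lee_fin mulr_ge0 ?powR_pos_ge0.
rewrite {1}/ebeta (@ge0_integral_affine R t 0 h t0 mh h0) /h.
under eq_integral => x _.
  rewrite (_ : _ * _ = t `^ (a - 1 + (b - 1)) *
    (powR_pos a x * powR_pos b (1 - x))); last first.
    rewrite /powR_pos addr0 -[X in X - t * x]mulr1 -mulrBr !pmulr_rgt0//.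
    rewrite [RHS]mulrC (@powRD _ t); last by apply/implyP => _; rewrite gt_eqF.
    case: ifPn => x0; rewrite ?mul0r ?mulr0//.
    case: ifPn => x1; rewrite ?mul0r ?mulr0 ?mul0r//.
    by rewrite !powRM ?(ltW t0) ?(ltW x0) ?(ltW x1)//; ring.
  rewrite EFinM; over.
rewrite ge0_integralZl_EFin ?powR_ge0//; last 2 first.
- by move=> x _; rewrite lee_fin mulr_ge0 ?powR_pos_ge0.
- by apply/measurable_EFinP; exact: measurable_ebeta_integrand.
rewrite muleA -EFinM /powR_pos t0; congr (EFin _ * _)%E.
rewrite -{1}(powRr1 (ltW t0)) -(@powRD _ t); last by apply/implyP => _; rewrite gt_eqF.
by congr powR; ring.
Qed.

(* Both sides are the double integral of [x^(a-1) (s-x)^(b-1) e^(-s)] over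
   [0 < x < s]. *)
Lemma egammaM {R : realType} (a b : R) :
  (egamma a * egamma b = ebeta a b 1 * egamma (a + b))%E.
Proof.
pose mu := @lebesgue_measure R.
pose F (z : R * R) :=
  (powR_pos a z.1 * powR_pos b (z.2 - z.1) * expR (- z.2))%:E.
have mF : measurable_fun setT F.
  apply/measurable_EFinP; apply: measurable_funM.
    apply: measurable_funM.
      by apply: measurableT_comp; [exact: measurable_powR_pos|].
    apply: measurableT_comp; first exact: measurable_powR_pos.
    by apply: measurable_funB.
  by apply: measurableT_comp => //; apply: measurableT_comp.
have F0 z : (0 <= F z)%E.
  by rewrite lee_fin !mulr_ge0 ?powR_pos_ge0 ?expR_ge0.
have g0 (s x : R) : (0 <= (powR_pos s x * expR (- x))%:E)%E.
  by rewrite lee_fin !mulr_ge0 ?powR_pos_ge0 ?expR_ge0.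
transitivity (\int[mu]_x \int[mu]_y F (x, y))%E.
  rewrite /egamma -ge0_integralZr//; last 2 first.
  - by apply/measurable_EFinP; exact: measurable_egamma_integrand.
  - exact: egamma_ge0.
  apply: eq_integral => x _.
  (* Translating the inner variable by x merges the two exponentials into one that depends only on
     the outer sum s. *)
  rewrite (@ge0_integral_affine R 1 (- x))//; last first.
    by apply/measurable_EFinP; exact: measurable_egamma_integrand.
  rewrite mul1e -ge0_integralZl_EFin//; last 2 first.
  - by apply/measurable_EFinP; apply: (measurableT_comp (measurable_egamma_integrand b));
      exact: measurable_affine.
  - by rewrite mulr_ge0 ?powR_pos_ge0 ?expR_ge0.
  apply: eq_integral => y _; rewrite -EFinM /F/= mul1r; congr EFin.
  rewrite mulrACA -expRD; congr (_ * expR _); ring.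
rewrite fubini_tonelli//.
rewrite -ge0_integralZl//; last 2 first.
- by apply/measurable_EFinP; exact: measurable_egamma_integrand.
- exact: ebeta_ge0.
(* After Tonelli the inner integral is [ebeta a b y], and scaling extracts the power y^(a+b-1) of
   the integrand of [egamma (a + b)]. *)
apply: eq_integral => y _; rewrite EFinM muleA [X in (X * _)%E]muleC -ebeta_scale.
rewrite /F/= muleC /ebeta -ge0_integralZl_EFin ?expR_ge0//; last 2 first.
- by move=> x _; rewrite lee_fin mulr_ge0 ?powR_pos_ge0.
- by apply/measurable_EFinP; exact: measurable_ebeta_integrand.
by apply: eq_integral => x _; rewrite EFinM muleC.
Qed.

(** * The Gamma function *)

(** This is the total mass of the exponential distribution of rate 1. *)
Lemma egamma1 {R : realType} : egamma (1 : R) = 1%E.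
Proof.
rewrite -(@integral_exponential_pdf R 1 ltr01).
pose f (x : R) := (expR (- x))%:E.
transitivity (\int[@lebesgue_measure R]_(x in `]0%R, +oo[) f x)%E.
  rewrite [RHS]integral_mkcond; apply: eq_integral => x _.
  rewrite /powR_pos patchE mem_setE in_itv/= andbT.
  by case: ifPn; rewrite ?mul0r// subrr powRr0 mul1r.
rewrite integral_itv_obnd_cbnd; last first.
  apply: measurable_funTS; apply/measurable_EFinP.
  by apply: measurableT_comp => //; apply: measurableT_comp.
rewrite integral_mkcond; apply: eq_integral => x _.
rewrite /exponential_pdf !patchE; case: ifPn => // _.
by rewrite /f mul1r mulN1r.
Qed.

(** For s < 1 the integrand is singular at 0, so the fundamental theorem of calculus is applied on
    [1/(n+2), 1], followed by a monotone limit in n. *)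
Lemma ebeta_r1 {R : realType} (s : R) : 0 < s -> ebeta s 1 1 = (s^-1)%:E.
Proof.
move=> s0; pose f (x : R) := (x `^ (s - 1))%:E.
have mf : measurable_fun [set: R] f by apply/measurable_EFinP.
(* Starting at n+2 keeps the left endpoint strictly below 1 for n = 0 as well. *)
pose F n : set R := `[n.+2%:R^-1, 1]%classic.
have Fn0 n : 0 < n.+2%:R^-1 :> R by rewrite invr_gt0 ltr0n.
have intF n : (\int[@lebesgue_measure R]_(x in F n) f x =
    (s^-1 * (1 - n.+2%:R^-1 `^ s))%:E)%E.
  have d (x : R) : 0 < x -> is_derive x 1 (fun x => s^-1 * x `^ s) (x `^ (s - 1)).
    move=> x0.
    have -> : x `^ (s - 1) = s^-1 *: (s * x `^ (s - 1)).
      by rewrite /GRing.scale/= mulrA mulVf ?mul1r// gt_eqF.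
    exact: (is_deriveZ _ (is_derive1_powR s x0)).
  have c (x : R) : 0 < x -> {for x, continuous (fun x => s^-1 * x `^ s)}.
    by move=> x0; apply/differentiable_continuous/derivable1_diffP; have [] := d _ x0.
  rewrite (@continuous_FTC2 R _ (fun x => s^-1 * x `^ s)).
  - by rewrite powR1 mulrBr mulr1 -EFinB.
  - by rewrite invf_lt1 ?ltr1n ?ltr0n.
  - apply: continuous_in_subspaceT => x; rewrite inE/= in_itv/= => /andP[nx _].
    have x0 := lt_le_trans (Fn0 n) nx.
    apply/differentiable_continuous/derivable1_diffP.
    by have [] := is_derive1_powR (s - 1) x0.
  - split.
    + move=> x; rewrite in_itv/= => /andP[nx _].
      by have [] := d _ (lt_trans (Fn0 n) nx).
    + exact: cvg_at_right_filter (c _ (Fn0 n)).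
    + exact: cvg_at_left_filter (c _ ltr01).
  - move=> x; rewrite in_itv/= => /andP[nx _]; rewrite derive1E.
    by have [_ ->] := d _ (lt_trans (Fn0 n) nx).
have bF : \bigcup_n F n = `]0, 1]%classic.
  apply/seteqP; split => [x [n _]|x]; rewrite /F /= !in_itv/= => /andP[x0 x1].
    by rewrite x1 (lt_le_trans (Fn0 n) x0).
  exists (Num.truncn x^-1) => //; rewrite /= in_itv/= x1 andbT.
  rewrite invf_ple ?posrE ?ltr0n//.
  by rewrite ltW// (lt_trans (truncnS_gt _))// ltr_nat.
transitivity (\int[@lebesgue_measure R]_(x in `]0%R, 1%R]) f x)%E.
  rewrite -integral_itv_bndo_bndc; last exact: measurable_funTS.
  rewrite [RHS]integral_mkcond; apply: eq_integral => x _.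
  rewrite /powR_pos patchE mem_setE in_itv/= subr_gt0 subrr powRr0.
  by case: (0 < x) => /=; rewrite ?mul0r//; case: ifP; rewrite ?mulr0 ?mulr1.
rewrite -bF.
have ndF : nondecreasing_seq F.
  apply/nondecreasing_seqP => n; rewrite subsetEset => x/=.
  rewrite /F/= !in_itv/= => /andP[+ ->]; rewrite andbT; apply: le_trans.
  by rewrite lef_pV2 ?posrE ?ltr0n// ler_nat.
have : (\int[@lebesgue_measure R]_(x in F n) f x)%E @[n --> \oo] -->
    (\int[@lebesgue_measure R]_(x in \bigcup_n F n) f x)%E.
  apply: ge0_nondecreasing_set_cvg_integral => //.
  - by move=> n; exact: measurable_itv.
  - by move=> n; exact: measurable_funTS.
  - by move=> n x _; rewrite lee_fin powR_ge0.
under eq_fun do rewrite intF.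
move/cvg_lim => <- //; apply/cvg_lim => //; apply: cvg_EFin; first exact: nearW.
rewrite -[X in _ --> X]mulr1; apply: cvgM; first exact: cvg_cst.
rewrite -[X in _ --> X]subr0; apply: cvgB; first exact: cvg_cst.
have /cvg_at_rightP := @powR_cvg0 R s s0; apply; split=> //.
by have := @cvg_harmonic R; rewrite -cvg_shiftS.
Qed.

(** The case b = 1 of [egammaM] replaces integration by parts. It is an identity of extended reals,
    so it is available before finiteness is known and serves to prove it. *)
Lemma egammaS {R : realType} (s : R) : 0 < s ->
  egamma s = ((s^-1)%:E * egamma (s + 1))%E.
Proof. by move=> s0; rewrite -ebeta_r1// -egammaM egamma1 mule1. Qed.

(** Positive integers follow by recursion; a real r >= 1 is compared with integers, since x^(r-1) <=
    1 + x^n for n = [truncn r]; the functional equation then brings every s > 0 back to s + 1 >=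
    1. *)
Lemma egamma_lty {R : realType} (s : R) : 0 < s -> (egamma s < +oo)%E.
Proof.
have nat_lty n : (egamma (n.+1%:R : R) < +oo)%E.
  elim: n => [|n ih]; first by rewrite egamma1 ltry.
  have := @egammaS R n.+1%:R; rewrite ltr0n => /(_ isT).
  rewrite natr1; move: ih; have := @egamma_ge0 R n.+2%:R.
  case: (egamma n.+2%:R) => [r| |] //; first by rewrite ltry.
  (* An infinite value at n+2 would force an infinite value at n+1. *)
  move=> _ + E; rewrite E gt0_muley ?ltxx// lte_fin invr_gt0 ltr0n//.
have ge1 (r : R) : 1 <= r -> (egamma r < +oo)%E.
  move=> r1; pose n := Num.truncn r.
  apply: (@le_lt_trans _ _ (egamma 1 + egamma n.+1%:R)%E); last first.
    by rewrite lte_add_pinfty// egamma1 ltry.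
  rewrite /egamma -ge0_integralD//; last 4 first.
  - by move=> x _; rewrite lee_fin mulr_ge0 ?powR_pos_ge0 ?expR_ge0.
  - by apply/measurable_EFinP; exact: measurable_egamma_integrand.
  - by move=> x _; rewrite lee_fin mulr_ge0 ?powR_pos_ge0 ?expR_ge0.
  - by apply/measurable_EFinP; exact: measurable_egamma_integrand.
  apply: ge0_le_integral => //.
  - by move=> x _; rewrite lee_fin mulr_ge0 ?powR_pos_ge0 ?expR_ge0.
  - by apply/measurable_EFinP; exact: measurable_egamma_integrand.
  - apply/measurable_EFinP; apply: measurable_funD; exact: measurable_egamma_integrand.
  - move=> x _; rewrite -EFinD lee_fin -mulrDl ler_wpM2r ?expR_ge0// /powR_pos.
    case: ifPn => [x0|_]; last by rewrite addr0.
    rewrite subrr powRr0; have [x1|x1] := leP x 1.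
      rewrite (le_trans (_ : _ <= 1)) ?lerDl ?powR_ge0//.
      by rewrite -[leRHS](powRr0 x) ger_powR ?x0/= ?subr_ge0.
    rewrite (le_trans (_ : _ <= x `^ (n.+1%:R - 1))) ?lerDr//.
    by rewrite ler_powR ?(ltW x1)// lerD2r ltW// truncnS_gt.
move=> s0; rewrite egammaS//.
have := ge1 (s + 1); rewrite lerDr (ltW s0) => /(_ isT).
have := @egamma_ge0 R (s + 1); case: (egamma (s + 1)) => // r _ _.
by rewrite -EFinM ltry.
Qed.

Lemma EFin_Gamma {R : realType} (s : R) : 0 < s -> (Gamma s)%:E = egamma s.
Proof.
by move=> s0; rewrite egammaE fineK// ge0_fin_numE ?egamma_ge0 ?egamma_lty.
Qed.

Lemma Gamma1 {R : realType} : Gamma (1 : R) = 1.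
Proof. by rewrite egammaE egamma1. Qed.

Lemma GammaS {R : realType} (s : R) : 0 < s -> Gamma (s + 1) = s * Gamma s.
Proof.
move=> s0; apply: EFin_inj; rewrite EFinM !EFin_Gamma// ?addr_gt0// (egammaS s s0).
by rewrite muleA -EFinM mulfV ?mul1e// gt_eqF.
Qed.

(** Keep only the part of Euler's integral over [M, M+1] and bound each factor below there. As M is
    free, Gamma outgrows every geometric sequence. *)
Lemma Gamma_ge_powR {R : realType} (M s : R) : 0 < M -> 1 <= s ->
  M `^ (s - 1) * expR (- (M + 1)) <= Gamma s.
Proof.
move=> M0 s1; have s0 := lt_le_trans ltr01 s1.
rewrite -lee_fin EFin_Gamma//.
have -> : (M `^ (s - 1) * expR (- (M + 1)))%:E =
    (\int[@lebesgue_measure R]_(x in `[M, (M + 1)%R])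
      (cst (M `^ (s - 1) * expR (- (M + 1)))%:E) x)%E.
  rewrite integral_cst// [X in (_ * X)%E](_ : _ = 1%E) ?mule1//.
  apply: (etrans (@lebesgue_measure_itv R `[M, M + 1]%R)); rewrite /= lte_fin ltrDl ltr01.
  by rewrite -EFinD [M + 1]addrC addrK.
rewrite integral_mkcond; apply: ge0_le_integral => //.
- move=> x _; rewrite patchE; case: ifP => // _.
  by rewrite lee_fin mulr_ge0 ?powR_ge0 ?expR_ge0.
- by apply/measurable_restrict => //; exact: measurable_cst.
- by apply/measurable_EFinP; exact: measurable_egamma_integrand.
- move=> x _; rewrite patchE mem_setE in_itv/=; case: ifP => [/andP[Mx xM]|_].
    rewrite lee_fin /powR_pos (lt_le_trans M0 Mx).
    rewrite ler_pM ?powR_ge0 ?expR_ge0//; last by rewrite ler_expR lerN2.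
    by rewrite ge0_ler_powR ?subr_ge0 ?nnegrE ?(ltW M0)// (le_trans (ltW M0)).
  by rewrite lee_fin mulr_ge0 ?powR_pos_ge0 ?expR_ge0.
Qed.

Lemma Gamma_gt0 {R : realType} (s : R) : 0 < s -> 0 < Gamma s.
Proof.
(* The lower bound requires an argument at least 1, hence the passage to s + 1. *)
move=> s0; rewrite -(pmulr_rgt0 _ s0) -GammaS//.
have : 1 <= s + 1 by rewrite lerDr ltW.
move=> /(Gamma_ge_powR _ _ ltr01); apply: lt_le_trans.
by rewrite powR1 mul1r expR_gt0.
Qed.

Lemma ebetaE {R : realType} (a b t : R) : 0 < a -> 0 < b -> 0 < t ->
  ebeta a b t = (t `^ (a + b - 1) * (Gamma a * Gamma b / Gamma (a + b)))%:E.
Proof.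
move=> a0 b0 t0; have ab0 := addr_gt0 a0 b0.
rewrite ebeta_scale /powR_pos t0 EFinM; congr (_ * _)%E.
have := @egammaM R a b; rewrite -!EFin_Gamma//.
have := @ebeta_ge0 R a b 1; have := Gamma_gt0 _ ab0.
case: (ebeta a b 1) => [r| |] //= G0 _.
  by rewrite -!EFinM => -[->]; rewrite mulfK// gt_eqF.
(* An infinite Beta integral times Gamma(a+b) > 0 would be infinite, whereas Gamma(a) Gamma(b) is
   finite. *)
by rewrite gt0_mulye.
Qed.

(** * Entire power series *)

Definition entire {R : realType} (c : nat -> R) : Prop :=
  forall z : R, cvgn (pseries c z).

Lemma entire_norm {R : realType} (c : nat -> R) :
  entire c -> entire (fun n => `|c n|).
Proof.
move=> ec z; apply: (@is_cvg_pseries_inside_norm _ _ (`|z| + 1)); first exact: ec.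
by rewrite [ltRHS]ger0_norm ?addr_ge0// ltrDl.
Qed.

(** The factor M^n is absorbed by evaluating the majorant series at M |z|. *)
Lemma entire_le {R : realType} (c d : nat -> R) (K M : R) :
  entire d -> (forall n, `|c n| <= K * M ^+ n * d n) -> entire c.
Proof.
move=> ed cd z; apply: normed_cvg.
have le n : `|c n * z ^+ n| <= K * (d n * (M * `|z|) ^+ n).
  rewrite normrM normrX (le_trans (ler_wpM2r _ (cd n))) ?exprn_ge0// exprMn.
  by rewrite le_eqVlt; apply/orP; left; apply/eqP; ring.
apply: (series_le_cvg _ _ le) => // [n|]; first exact: le_trans (le n).
exact/is_cvg_seriesZ/ed.
Qed.

(** Since n+1 <= 2^(n+1), the factor produced by differentiation is absorbed by doubling the radius;
    the majorant is the series of |c_n| r^n without its term of index 0. *)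
Lemma entire_diffs {R : realType} (c : nat -> R) :
  entire c -> entire (pseries_diffs c).
Proof.
move=> ec z; apply: normed_cvg.
pose r := 2 * (`|z| + 1).
have z1 : 0 <= `|z| + 1 by rewrite addr_ge0.
have le n : `|pseries_diffs c n * z ^+ n| <= `|c n.+1| * r ^+ n.+1.
  rewrite /pseries_diffs !normrM normr_nat normrX [_%:R * _]mulrC -mulrA.
  rewrite ler_wpM2l// /r exprMn ler_pM//.
    by rewrite -natrX ler_nat ltnW// ltn_expl.
  rewrite exprS (le_trans (_ : _ <= (`|z| + 1) ^+ n))//.
    by rewrite lerXn2r ?nnegrE ?lerDl.
  by rewrite ler_peMl ?exprn_ge0// lerDr.
apply: (series_le_cvg _ _ le) => // [n|]; first exact: le_trans (le n).
have /(_ r)/cvg_ex[/= l] := entire_norm _ ec; rewrite -cvg_shiftS => cl.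
apply/cvg_ex; exists (l - `|c 0%N| * r ^+ 0).
rewrite [X in X @ _ --> _](_ : _ = fun n =>
    pseries (fun n => `|c n|) r n.+1 - `|c 0%N| * r ^+ 0).
  by apply: cvgB => //; exact: cvg_cst.
by apply/funext => n; rewrite /pseries /series/= big_nat_recl//= addrC addKr.
Qed.

Lemma is_derive_pseries {R : realType} (c : nat -> R) (z : R) : entire c ->
  is_derive z 1 (fun x => limn (pseries c x)) (limn (pseries (pseries_diffs c) z)).
Proof.
move=> ec; apply: (@pseries_snd_diffs _ _ (`|z| + 1)).
- exact: ec.
- exact: entire_diffs.
- by do 2 apply: entire_diffs.
- by rewrite [ltRHS]ger0_norm ?addr_ge0// ltrDl.
Qed.

(** The bound is uniform in both n and |z| <= b, as dominated convergence will require. *)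
Lemma pseries_le {R : realType} (c : nat -> R) (z b : R) (n : nat) :
  entire c -> `|z| <= b ->
  `|pseries c z n| <= limn (pseries (fun n => `|c n|) b).
Proof.
move=> ec zb; have b0 : 0 <= b by exact: le_trans zb.
apply: (@le_trans _ _ (pseries (fun n => `|c n|) b n)).
  apply: (le_trans (ler_norm_sum _ _ _)); apply: ler_sum => i _.
  by rewrite normrM normrX ler_wpM2l// lerXn2r.
apply: nondecreasing_cvgn_le; last exact: entire_norm.
by apply: nondecreasing_series => i _ _; rewrite mulr_ge0 ?exprn_ge0.
Qed.

Lemma lim_pseries_le {R : realType} (c : nat -> R) (z b : R) :
  entire c -> `|z| <= b ->
  `|limn (pseries c z)| <= limn (pseries (fun n => `|c n|) b).
Proof.
move=> ec zb; rewrite -lim_norm; last exact: ec.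
apply: limr_le; first by apply: is_cvg_norm; exact: ec.
by apply: nearW => n; exact: pseries_le.
Qed.

Lemma entire_invGamma {R : realType} (a b : R) : 0 < a -> 1 <= b ->
  entire (fun k => (Gamma (a * k%:R + b))^-1).
Proof.
move=> a0 b1 z; apply: normed_cvg.
pose L := 2 * (`|z| + 1).
have L1 : 1 <= L by rewrite /L; have := normr_ge0 z; lra.
have L0 := lt_le_trans ltr01 L1.
(* Gamma(s) >= M^(s-1) e^(-M-1) with M^a = 2(|z|+1) gives geometric decay. *)
pose M := L `^ a^-1.
have M0 : 0 < M by exact: powR_gt0.
have M1 : 1 <= M by rewrite -[leLHS](powRr0 L) ler_powR// invr_ge0 ltW.
have ak k : 0 <= a * k%:R by rewrite mulr_ge0// ltW.
have arg1 k : 1 <= a * k%:R + b by have := ak k; lra.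
have le k : `|(Gamma (a * k%:R + b))^-1 * z ^+ k| <=
    (expR (M + 1)) * (2^-1 ^+ k).
  have G0 : 0 < Gamma (a * k%:R + b) by rewrite Gamma_gt0// (lt_le_trans ltr01).
  rewrite normrM normrX ger0_norm ?invr_ge0 ?(ltW G0)//.
  rewrite mulrC ler_pdivrMr// -ler_pdivrMl ?mulr_gt0 ?expR_gt0 ?exprn_gt0//.
  apply: le_trans (Gamma_ge_powR _ _ M0 (arg1 k)).
  rewrite invfM -expRN -exprVn invrK -mulrA [leLHS]mulrC ler_wpM2r ?expR_ge0//.
  rewrite -exprMn; apply: (@le_trans _ _ (M `^ (a * k%:R))).
    rewrite /M -powRrM mulrA mulVf ?gt_eqF// mul1r powR_mulrn ?(ltW L0)//.
    by rewrite lerXn2r ?nnegrE ?mulr_ge0 ?(ltW L0)// /L ler_pM2l// lerDl.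
  by rewrite ler_powR//; lra.
apply: (series_le_cvg _ _ le) => //.
by apply: is_cvg_geometric_series; rewrite ger0_norm// invf_lt1// ltr1n.
Qed.

(** * Absolute continuity of functions of t^alpha *)

Lemma sum_disjoint_increments_le {R : realType} (h : R -> R) (n : nat)
    (l r : 'I_n -> R) (S : {set 'I_n}) (a b : R) :
  a <= b -> (forall x y, a <= x -> x <= y -> y <= b -> h x <= h y) ->
  (forall i, i \in S -> a <= l i /\ l i <= r i /\ r i <= b) ->
  (forall i j, i != j -> r i <= l j \/ r j <= l i) ->
  \sum_(i in S) (h (r i) - h (l i)) <= h b - h a.
Proof.
(* Induction on the number of intervals: the others lie to the left or to the
   right of any chosen one. *)
move=> + + + disj; move: {2}(#|S|)%N (leqnn #|S|) a b => m.
elim: m S => [|m ih] S; rewrite ?leqn0.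
  move=> /eqP/cards0_eq -> a b ab hh _.
  by rewrite big_set0 subr_ge0 hh.
have [->|[i iS]] := set_0Vmem S.
  by move=> _ a b ab hh _; rewrite big_set0 subr_ge0 hh.
move=> Sm a b ab hh Sab; have [ali [lri rib]] := Sab _ iS.
have cardi : (#|S :\ i| <= m)%N.
  by rewrite -ltnS (leq_trans _ Sm)// [in leqRHS](cardsD1 i) iS.
pose L := [set j in S :\ i | r j <= l i].
pose P := [set j in S :\ i | ~~ (r j <= l i)].
have sL : L \subset S :\ i by apply/fintype.subsetP => j; rewrite inE => /andP[].
have sP : P \subset S :\ i by apply/fintype.subsetP => j; rewrite inE => /andP[].
rewrite (big_setD1 i)//= (bigID (fun j => r j <= l i))/=.
have -> : \sum_(j in S :\ i | r j <= l i) (h (r j) - h (l j)) =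
    \sum_(j in L) (h (r j) - h (l j)) by apply: eq_bigl => j; rewrite [in RHS]inE.
have -> : \sum_(j in S :\ i | ~~ (r j <= l i)) (h (r j) - h (l j)) =
    \sum_(j in P) (h (r j) - h (l j)) by apply: eq_bigl => j; rewrite [in RHS]inE.
have HL : \sum_(j in L) (h (r j) - h (l j)) <= h (l i) - h a.
  apply: ih; rewrite ?(leq_trans (subset_leq_card sL))//.
  - by move=> x y ax xy yl; rewrite hh// (le_trans yl)// (le_trans lri).
  - move=> j; rewrite !inE => /andP[/andP[_ jS] rl].
    by have [? [? _]] := Sab _ jS.
have HP : \sum_(j in P) (h (r j) - h (l j)) <= h b - h (r i).
  apply: ih; rewrite ?(leq_trans (subset_leq_card sP))//.
  - by move=> x y rx xy yb; rewrite hh// (le_trans _ rx)// (le_trans ali).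
  - move=> j; rewrite !inE => /andP[/andP[ji jS] /negP rl].
    by have [? [? ?]] := Sab _ jS; have [] := disj _ _ ji.
lra.
Qed.

Lemma powR_increment_le {R : realType} (al x y : R) : al <= 1 -> 0 < x -> x <= y ->
  y `^ al - x `^ al <= x `^ (al - 1) * (y - x).
Proof.
move=> al1 x0 xy; have y0 := lt_le_trans x0 xy.
have le : y `^ (al - 1) <= x `^ (al - 1).
  rewrite -opprB !powRN lef_pV2 ?posrE ?powR_gt0//.
  by rewrite ge0_ler_powR ?subr_ge0 ?nnegrE ?(ltW x0) ?(ltW y0).
have E (u : R) : 0 < u -> u `^ al = u `^ (al - 1) * u.
  move=> u0; rewrite -{3}(powRr1 (ltW u0)) -(@powRD _ u) ?subrK//.
  by apply/implyP => _; rewrite gt_eqF.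
by rewrite !E// mulrBr lerB// ler_wpM2r// ltW.
Qed.

Lemma abs_continuous_comp_powR {R : realType} (al T K : R) (g : R -> R) :
  0 < al -> al <= 1 -> 0 < T ->
  (forall x y, 0 <= x -> x <= y -> y <= T `^ al -> `|g y - g x| <= K * (y - x)) ->
  abs_continuous 0 T (fun s => g (s `^ al)).
Proof.
move=> al0 al1 T0 gK e e0.
(* K may be zero or negative; k is a positive Lipschitz constant. Then eta is chosen with k eta^al =
   e/2, and the final d with k eta^(al-1) d = e/2. *)
pose k := `|K| + 1.
have k0 : 0 < k by rewrite /k ltr_pwDr.
have Kk : K <= k by rewrite /k (le_trans (ler_norm _))// lerDl.
have ek0 : 0 < e / (2 * k) by rewrite divr_gt0// mulr_gt0.
pose eta := (e / (2 * k)) `^ al^-1.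
have eta0 : 0 < eta by exact: powR_gt0.
have etaE : eta `^ al = e / (2 * k).
  by rewrite /eta -powRrM mulVf ?gt_eqF// powRr1// ltW.
have c0 : 0 < eta `^ (al - 1) by exact: powR_gt0.
exists (e / (2 * (k * eta `^ (al - 1)))); first by rewrite divr_gt0// !mulr_gt0.
move=> n l r Hlr disj Hd.
(* Below eta the increments telescope to at most eta^al; above eta the map is
   Lipschitz with constant eta^(al-1). *)
pose h (s : R) := Num.min s eta `^ al.
have hh x y : 0 <= x -> x <= y -> y <= T -> h x <= h y.
  move=> x0 xy _; rewrite /h ge0_ler_powR ?(ltW al0) ?nnegrE//.
  - by rewrite le_min x0 ltW.
  - by rewrite le_min (le_trans x0 xy) ltW.
  - by rewrite le_min !ge_min xy lexx orbT.
have incr x y : 0 <= x -> x <= y ->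
    y `^ al - x `^ al <= (h y - h x) + eta `^ (al - 1) * (y - x).
  move=> x0 xy; have y0 := le_trans x0 xy.
  have cxy : 0 <= eta `^ (al - 1) * (y - x) by rewrite mulr_ge0 ?powR_ge0 ?subr_ge0.
  rewrite /h; have [ye|ey] := leP y eta.
    by rewrite !min_l ?(le_trans xy ye)// lerDl.
  (* An interval straddling eta is split there: [h] accounts for the part below, the Lipschitz bound
     for the part above. *)
  have [xe|ex] := leP x eta.
    have := powR_increment_le _ _ _ al1 eta0 (ltW ey).
    have : eta `^ (al - 1) * (y - eta) <= eta `^ (al - 1) * (y - x).
      by rewrite ler_pM2l// lerB.
    lra.
  have x1 := lt_trans eta0 ex.
  have := powR_increment_le _ _ _ al1 x1 xy.
  have : x `^ (al - 1) * (y - x) <= eta `^ (al - 1) * (y - x).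
    rewrite ler_wpM2r ?subr_ge0// -opprB !powRN lef_pV2 ?posrE ?powR_gt0//.
    by rewrite ge0_ler_powR ?subr_ge0 ?nnegrE ?(ltW x1) ?(ltW eta0) ?(ltW ex).
  lra.
apply: (@le_lt_trans _ _ (\sum_(i < n) (k * (h (r i) - h (l i)) +
    k * eta `^ (al - 1) * (r i - l i)))).
  apply: ler_sum => i _; have [l0 [lr rT]] := Hlr i.
  have r0 := le_trans l0 lr.
  have Hal (u v : R) : 0 <= u -> u <= v -> u `^ al <= v `^ al.
    by move=> u0 uv; rewrite ge0_ler_powR ?(ltW al0) ?nnegrE// (le_trans u0).
  apply: (le_trans (gK _ _ (powR_ge0 _ _) (Hal _ _ l0 lr) (Hal _ _ r0 rT))).
  apply: (@le_trans _ _ (k * (r i `^ al - l i `^ al))).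
    by rewrite ler_wpM2r// subr_ge0 Hal.
  by rewrite -mulrA -mulrDr ler_pM2l// incr.
rewrite big_split/= -!mulr_sumr.
have H1 : \sum_(i < n) (h (r i) - h (l i)) <= eta `^ al.
  have := @sum_disjoint_increments_le R h n l r [set: 'I_n] 0 T (ltW T0) hh
    (fun i _ => Hlr i) disj.
  under eq_bigl do rewrite inE.
  move=> /le_trans; apply.
  rewrite /h lerBlDr (le_trans (_ : _ <= eta `^ al)) ?lerDl ?powR_ge0//.
  rewrite ge0_ler_powR ?(ltW al0) ?nnegrE ?(ltW eta0) ?ge_min ?lexx ?orbT//.
  by rewrite le_min !ltW.
have H2 : k * eta `^ (al - 1) * \sum_(i < n) (r i - l i) < e / 2.
  have kc : 0 < k * eta `^ (al - 1) by rewrite mulr_gt0.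
  move: Hd; rewrite -(ltr_pM2l kc); congr (_ < _).
  by field; rewrite !gt_eqF.
have : k * \sum_(i < n) (h (r i) - h (l i)) <= e / 2.
  rewrite (le_trans (ler_wpM2l (ltW k0) H1))// etaE le_eqVlt.
  by apply/orP; left; apply/eqP; field; rewrite gt_eqF.
lra.
Qed.

(** * Termwise Caputo derivative *)

(** The endpoints are null, so [F] may take any values there. This replaces the Caputo integrand,
    uncontrolled at 0 and t, by a function on the whole line. *)
Lemma Rintegral_itvcc_extension {R : realType} (a b : R) (F Phi : R -> R) :
  (forall x, x \in `]a, b[ -> F x = Phi x) ->
  (forall x, x \notin `]a, b[ -> Phi x = 0) ->
  (@lebesgue_measure R).-integrable setT (EFin \o Phi) ->
  (@lebesgue_measure R).-integrable `[a, b] (EFin \o F) /\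
  \int[@lebesgue_measure R]_(x in `[a, b]) F x = \int[@lebesgue_measure R]_x Phi x.
Proof.
move=> FP P0 iP; have [mP fP] := integrableP _ _ _ iP.
have mF : measurable_fun (`]a, b[%classic : set R) (EFin \o F).
  apply: (@eq_measurable_fun _ _ _ _ _ (EFin \o Phi)); last exact: measurable_funTS.
  by move=> x; rewrite inE/= => xab; rewrite FP.
(* Used with g the absolute value for integrability, and with g the identity for the value. *)
have eqoo (g : \bar R -> \bar R) : g 0%E = 0%E ->
    (\int[@lebesgue_measure R]_(x in `]a, b[) g (F x)%:E =
     \int[@lebesgue_measure R]_x g (Phi x)%:E)%E.
  move=> g0; rewrite integral_mkcond; apply: eq_integral => x _.
  rewrite patchE mem_setE; case: ifPn => [/FP -> //|/P0 ->].
  by rewrite g0.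
have mFcc : measurable_fun (`[a, b]%classic : set R) (EFin \o F).
  apply/emeasurable_fun_itv_obnd_cbndP.
  exact/emeasurable_fun_itv_bndo_bndcP.
split.
  apply/integrableP; split; first exact: mFcc.
  rewrite integral_itv_bndoo; last exact: measurableT_comp.
  by rewrite (eqoo abse abse0).
rewrite /Rintegral integral_itv_bndoo//; congr fine.
exact: (eqoo id).
Qed.

Section caputo_power_series.
Context {R : realType}.
Variables (al t : R) (c : nat -> R).
Hypotheses (al0 : 0 < al) (al1 : al < 1) (t0 : 0 < t) (ec : entire c).

Let d := pseries_diffs c.
Let ed : entire d. Proof. exact: entire_diffs. Qed.
Let G z := limn (pseries d z).
(** The kernel x^(al-1) (t-x)^(-al) on (0, t), whose first factor comes from the chain rule for
    x^al. Thus [Phi] is the Caputo integrand of the series in x^al, extended by 0, and [b] lists the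
    coefficients obtained by integrating it termwise. *)
Let ker x := powR_pos al x * powR_pos (1 - al) (t - x).
Let Phi x := ker x * (al * G (x `^ al)).
Let b n := d n * (al * (Gamma (al * n.+1%:R) * Gamma (1 - al) / Gamma (al * n%:R + 1))).

Let ker_ge0 x : 0 <= ker x. Proof. by rewrite mulr_ge0// powR_pos_ge0. Qed.

Let ker_eq0 x : x \notin `]0, t[ -> ker x = 0.
Proof.
rewrite in_itv/= /ker /powR_pos subr_gt0.
by case: (0 < x); case: (x < t) => //; rewrite ?mulr0 ?mul0r.
Qed.

Let ker_powR k x : ker x * (x `^ al) ^+ k =
  powR_pos (al * k.+1%:R) x * powR_pos (1 - al) (t - x).
Proof.
rewrite /ker mulrAC; congr (_ * _); rewrite /powR_pos.
case: ifPn => x0; last by rewrite mul0r.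
rewrite -powR_mulrn ?powR_ge0// -powRrM -(@powRD _ x); last first.
  by apply/implyP => _; rewrite gt_eqF.
by congr powR; rewrite -natr1; ring.
Qed.

Let argk_gt0 k : 0 < al * k.+1%:R. Proof. by rewrite mulr_gt0// ltr0n. Qed.
Let sal0 : 0 < 1 - al. Proof. by rewrite subr_gt0. Qed.

(** By [ker_powR] this is a Beta integral with parameters al(k+1) and 1 - al, whose sum is al k + 1.
    The integrand is nonnegative, so the finite value also yields integrability. *)
Let int_term k :
  (@lebesgue_measure R).-integrable setT (EFin \o (fun x => ker x * (x `^ al) ^+ k)) /\
  (\int[@lebesgue_measure R]_x (ker x * (x `^ al) ^+ k)%:E = ((t `^ al) ^+ k *
    (Gamma (al * k.+1%:R) * Gamma (1 - al) / Gamma (al * k%:R + 1)))%:E)%E.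
Proof.
have E : al * k.+1%:R + (1 - al) = al * k%:R + 1 by rewrite -natr1; ring.
have I : (\int[@lebesgue_measure R]_x (ker x * (x `^ al) ^+ k)%:E = ((t `^ al) ^+ k *
    (Gamma (al * k.+1%:R) * Gamma (1 - al) / Gamma (al * k%:R + 1)))%:E)%E.
  transitivity (ebeta (al * k.+1%:R) (1 - al) t).
    by apply: eq_integral => x _; rewrite ker_powR.
  rewrite (ebetaE _ _ _ (argk_gt0 k) sal0 t0).
  by rewrite E addrK powRrM powR_mulrn ?powR_ge0.
split=> //; apply/integrableP; split.
  apply/measurable_EFinP.
  under eq_fun do rewrite ker_powR.
  exact: measurable_ebeta_integrand.
rewrite (_ : (\int[_]_x _)%E =
    (\int[@lebesgue_measure R]_x (ker x * (x `^ al) ^+ k)%:E)%E).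
  by rewrite I ltry.
apply: eq_integral => x _ /=; rewrite ger0_norm// mulr_ge0// exprn_ge0//.
exact: powR_ge0.
Qed.

Let Phi_n n x := ker x * (al * pseries d (x `^ al) n).

Let Phi_nE n x : Phi_n n x =
  \sum_(0 <= k < n) (d k * al) * (ker x * (x `^ al) ^+ k).
Proof.
rewrite /Phi_n /pseries /series/= !mulr_sumr; apply: eq_bigr => k _; ring.
Qed.

Let int_Phi_n n :
  (\int[@lebesgue_measure R]_x (Phi_n n x)%:E = (pseries b (t `^ al) n)%:E)%E.
Proof.
under eq_integral do rewrite Phi_nE -sumEFin.
rewrite integral_sum//; last first.
  by move=> k; under eq_fun do rewrite EFinM;
    apply: integrableZl => //; exact: (int_term k).1.
rewrite /pseries /series/= -sumEFin; apply: eq_bigr => k _.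
under eq_integral do rewrite EFinM.
rewrite integralZl//; last exact: (int_term k).1.
by rewrite (int_term k).2 -EFinM /b; congr EFin; ring.
Qed.

Let measurable_Phi_n n : measurable_fun [set: R] (EFin \o Phi_n n).
Proof.
apply/measurable_EFinP; rewrite (_ : Phi_n n = (fun x =>
  \sum_(0 <= k < n) (d k * al) * (ker x * (x `^ al) ^+ k))); last first.
  by apply/funext => x; exact: Phi_nE.
apply: measurable_sum => k; apply: measurable_funM => //.
by have [/integrableP[/measurable_EFinP]] := int_term k.
Qed.

Let measurable_Phi : measurable_fun [set: R] (EFin \o Phi).
Proof.
apply/measurable_EFinP; apply: measurable_funM.
  exact: measurable_ebeta_integrand.
apply: measurable_funM => //; apply: measurableT_comp => //.
apply: continuous_measurable_fun => z.
apply/differentiable_continuous/derivable1_diffP.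
by have [] := @is_derive_pseries R d z ed.
Qed.

(** Dominated convergence for the partial sums [Phi_n]: on (0, t) one has x^al <= t^al, so they are
    bounded by al [B] times the kernel. The convergence of [pseries b] is an output of the
    theorem. *)
Lemma caputo_kernel_pseries :
  [/\ (@lebesgue_measure R).-integrable setT
        (EFin \o (fun x => powR_pos al x * powR_pos (1 - al) (t - x) *
          (al * limn (pseries (pseries_diffs c) (x `^ al))))) &
    \int[@lebesgue_measure R]_x (powR_pos al x * powR_pos (1 - al) (t - x) *
        (al * limn (pseries (pseries_diffs c) (x `^ al)))) =
    limn (pseries (fun n => pseries_diffs c n * (al *
      (Gamma (al * n.+1%:R) * Gamma (1 - al) / Gamma (al * n%:R + 1))))
      (t `^ al))].
Proof.
change ((@lebesgue_measure R).-integrable setT (EFin \o Phi) /\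
  \int[@lebesgue_measure R]_x Phi x = limn (pseries b (t `^ al))).
pose B := limn (pseries (fun n => `|d n|) (t `^ al)).
have cPhi x : (fun n => (Phi_n n x)%:E) @ \oo --> (Phi x)%:E.
  apply: cvg_EFin; first exact: nearW.
  apply: cvgM; first exact: cvg_cst.
  by apply: cvgM; [exact: cvg_cst|exact: ed].
(* The power 0 is kept so that integrability of the kernel is literally [int_term 0]. *)
have idom : (@lebesgue_measure R).-integrable setT
    (EFin \o (fun x => al * B * (ker x * (x `^ al) ^+ 0))).
  have := integrableZl measurableT (al * B) (int_term 0%N).1.
  by apply: eq_integrable => // x _; rewrite /= -EFinM.
have dom x n : (`|(Phi_n n x)%:E| <= (al * B * (ker x * (x `^ al) ^+ 0))%:E)%E.
  rewrite lee_fin expr0 mulr1 /Phi_n normrM (ger0_norm (ker_ge0 x)).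
  rewrite mulrC; case: (boolP (x \in `]0, t[)) => [|/ker_eq0 ->]; last by rewrite !mulr0.
  rewrite in_itv/= => /andP[x0 xt].
  rewrite ler_wpM2r// normrM (gtr0_norm al0) ler_pM2l//.
  apply: pseries_le => //; rewrite ger0_norm ?powR_ge0//.
  by rewrite ge0_ler_powR ?nnegrE ?(ltW al0) ?(ltW x0) ?(ltW t0) ?(ltW xt).
have [||iPhi _] := @dominated_convergence _ _ R (@lebesgue_measure R) setT
  measurableT (fun n x => (Phi_n n x)%:E) (EFin \o Phi) _ measurable_Phi_n
  measurable_Phi _ idom.
- by apply: aeW => x _; exact: cPhi.
- by apply: aeW => x n _; exact: dom.
rewrite (_ : [sequence _]_n = (fun n => (pseries b (t `^ al) n)%:E)); last first.
  by apply/funext => n /=; rewrite int_Phi_n.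
move=> cvI.
have Ifin := integrable_fin_num measurableT iPhi.
have cvb : pseries b (t `^ al) @ \oo --> \int[@lebesgue_measure R]_x Phi x.
  by move: cvI; rewrite -(fineK Ifin) => /fine_cvg.
split=> //.
by apply/esym/cvg_lim.
Qed.

End caputo_power_series.

(** Mean value theorem, with the derivative bounded on [0, b] by its absolute series at b. *)
Lemma pseries_lipschitz {R : realType} (c : nat -> R) (b x y : R) :
  entire c -> 0 <= x -> x <= y -> y <= b ->
  `|limn (pseries c y) - limn (pseries c x)| <=
  limn (pseries (fun n => `|pseries_diffs c n|) b) * (y - x).
Proof.
move=> ec x0 xy yb.
have dc (z : R) := is_derive_pseries c z ec.
have [|z] := @MVT_segment R (fun z => limn (pseries c z)) _ x y xy (fun z _ => dc z).
  apply: continuous_subspaceT => z.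
  by apply/differentiable_continuous/derivable1_diffP; have [] := dc z.
rewrite in_itv/= => /andP[xz zy] ->.
rewrite normrM (ger0_norm (_ : 0 <= y - x)) ?subr_ge0// ler_wpM2r ?subr_ge0//.
apply: lim_pseries_le; first exact: entire_diffs.
by rewrite ger0_norm ?(le_trans zy)// (le_trans x0).
Qed.

Lemma limn_pseriesZ {R : realType} (k : R) (c : nat -> R) (z : R) : entire c ->
  limn (pseries (fun n => k * c n) z) = k * limn (pseries c z).
Proof.
move=> ec; rewrite -[RHS](lim_seriesZ k (ec z)); congr (limn _).
by apply/funext => n; apply: eq_bigr => i _ /=; rewrite -mulrA.
Qed.

Lemma is_derive_pseries_powR {R : realType} (al C0 : R) (c : nat -> R) (s : R) :
  entire c -> 0 < s ->
  is_derive s 1 (fun s => C0 + limn (pseries c (s `^ al)))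
    (limn (pseries (pseries_diffs c) (s `^ al)) * (al * s `^ (al - 1))).
Proof.
move=> ec s0.
have D := @is_derive1_comp _ (fun z => limn (pseries c z)) (fun x => x `^ al) s _ _
  (is_derive_pseries c _ ec) (is_derive1_powR al s0).
have := is_deriveD (is_derive_cst C0 s 1) D.
by rewrite add0r.
Qed.

(** The functional equation of Gamma at al(n+1) cancels the factors n+1 and al coming from
    differentiation, which leaves the shifted sequence. The order al = 1 is handled by the ordinary
    chain rule. *)
Lemma frac_derive_pseries {R : realType} (al C0 : R) (a : nat -> R) (t : R) :
  0 < al -> al <= 1 -> 0 < t ->
  entire (fun n => a n / Gamma (al * n%:R + 1)) ->
  entire (fun n => a n.+1 / Gamma (al * n%:R + 1)) ->
  let f s := C0 + limn (pseries (fun n => a n / Gamma (al * n%:R + 1)) (s `^ al)) in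
  frac_derivable al f t /\
  frac_derive al f t =
    limn (pseries (fun n => a n.+1 / Gamma (al * n%:R + 1)) (t `^ al)).
Proof.
move=> al0 al1 t0; set c := (fun n => a n / _) => ec ec1 f.
have argk k : 0 < al * k.+1%:R by rewrite mulr_gt0// ltr0n.
have cE n : pseries_diffs c n * (al * Gamma (al * n.+1%:R)) = a n.+1.
  have G0 := Gamma_gt0 _ (argk n).
  rewrite /pseries_diffs /c GammaS//; field.
  by rewrite !gt_eqF//= nmulrn ltr0n.
rewrite /frac_derivable /frac_derive; case: ifPn => [/eqP al1E|aln1].
  have [D E] := is_derive_pseries_powR al C0 c t ec t0.
  split; first exact: D.
  rewrite derive1E E al1E subrr powRr0 !mulr1.
  congr (limn (pseries _ _)); apply/funext => n; rewrite -cE al1E.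
  have G0 := Gamma_gt0 _ (argk n); rewrite al1E in G0.
  by rewrite !mul1r natr1 mulfK// -[_.+1%:R]mul1r gt_eqF.
have {}al1 : al < 1 by rewrite lt_neqAle aln1.
have [iPhi IPhi] := caputo_kernel_pseries al t c al0 al1 t0 ec.
have [||iF IF] := Rintegral_itvcc_extension 0 t (caputo_integrand al f t) _ _ _ iPhi.
- move=> x; rewrite in_itv/= => /andP[x0 xt].
  rewrite /caputo_integrand derive1E.
  have [_ ->] := is_derive_pseries_powR al C0 c x ec x0.
  rewrite /powR_pos x0 subr_gt0 xt (_ : 1 - al - 1 = - al); last by ring.
  ring.
- move=> x; rewrite in_itv/= /powR_pos subr_gt0.
  by case: (0 < x); case: (x < t) => //; rewrite ?mulr0 ?mul0r.
split.
  split=> // T T0.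
  apply: (@abs_continuous_comp_powR R al T
    (limn (pseries (fun n => `|pseries_diffs c n|) (T `^ al)))
    (fun z => C0 + limn (pseries c z)) al0 (ltW al1) T0) => x y x0 xy yT.
  by rewrite opprD addrACA subrr add0r; exact: pseries_lipschitz.
rewrite /caputo IF IPhi.
have G1 : Gamma (1 - al) != 0 by rewrite gt_eqF// Gamma_gt0// subr_gt0.
(* The Caputo prefactor 1/Gamma(1-al) cancels the Gamma(1-al) common to all the Beta integrals. *)
rewrite -[RHS](mulKf G1); congr (_ * _); rewrite -limn_pseriesZ//.
by congr (limn (pseries _ _)); apply/funext => n; rewrite -cE; ring.
Qed.

(** * Mittag-Leffler functions as one interleaved series *)

(* Interleaves the coefficients of p E_{2al,1} and q m z E_{2al,al+1}, both
   taken at -m^2 z^2. *)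
Definition wave {R : realType} (m p q : R) (n : nat) : R :=
  (- m ^+ 2) ^+ n./2 * (if odd n then m * q else p).

(** Shifting exchanges the parities, and completing a pair yields a factor -m^2. For p = cos x and q
    = -sin x, the new pair (q, -p) is the x-derivative of (p, q). *)
Lemma waveS {R : realType} (m p q : R) (n : nat) :
  wave m p q n.+1 = m * wave m q (- p) n.
Proof.
rewrite /wave /= uphalf_half; case: (odd n) => /=; last by rewrite add0n; ring.
by rewrite add1n exprS; ring.
Qed.

(** |wave_n| <= (|p| + |q|) |m|^n: for odd n the missing power of |m| is the one multiplying q. *)
Lemma entire_wave {R : realType} (al m p q : R) : 0 < al ->
  entire (fun n => wave m p q n / Gamma (al * n%:R + 1)).
Proof.
move=> al0.
apply: (entire_le _ _ (`|p| + `|q|) `|m| (entire_invGamma al 1 al0 (lexx _))) => n.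
have G0 : 0 < Gamma (al * n%:R + 1) by rewrite Gamma_gt0// ltr_wpDl// mulr_ge0// ltW.
rewrite normrM [X in _ * X <= _]ger0_norm ?invr_ge0 ?(ltW G0)//.
rewrite ler_wpM2r ?invr_ge0 ?(ltW G0)// /wave normrM normrX normrN normrX -exprM.
have -> : `|m| ^+ n = `|m| ^+ (2 * n./2) * `|m| ^+ odd n.
  by rewrite -exprD mul2n addnC odd_double_half.
rewrite [leRHS]mulrC -mulrA ler_wpM2l ?exprn_ge0//.
case: (odd n); rewrite /= ?normrM; first by rewrite ler_wpM2l// lerDr.
by rewrite mul1r lerDl.
Qed.

Lemma series_evenodd {R : realType} (F : nat -> R) (N : nat) :
  series F N.*2 = series (fun k => F k.*2) N + series (fun k => F k.*2.+1) N.
Proof.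
elim: N => [|N ih]; first by rewrite /series /= !big_geq// addr0.
by rewrite doubleS !seriesSr ih; ring.
Qed.

Lemma cvg_double : (fun n => n.*2) @ \oo --> \oo.
Proof.
apply/cvgnyPge => A; near=> n.
by rewrite (@leq_trans n) -?addnn ?leq_addr//; near: n; exact: nbhs_infty_ge.
Unshelve. all: by end_near. Qed.

(** As the whole series converges, its sum is the limit of the partial sums of even length. These
    split by parity of the index, with al(2k) + 1 = 2al k + 1 and al(2k+1) + 1 = 2al k + (al +
    1). *)
Lemma limn_pseries_wave {R : realType} (al m p q z : R) : 0 < al ->
  limn (pseries (fun n => wave m p q n / Gamma (al * n%:R + 1)) z) =
  p * mittag_leffler (2%:R * al) 1 (- m ^+ 2 * z ^+ 2) +
  q * (m * z * mittag_leffler (2%:R * al) (al + 1) (- m ^+ 2 * z ^+ 2)).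
Proof.
move=> al0; have al20 : 0 < 2%:R * al by rewrite mulr_gt0.
pose F n := wave m p q n / Gamma (al * n%:R + 1) * z ^+ n.
have MLE b : (fun k => (- m ^+ 2 * z ^+ 2) ^+ k / Gamma (2%:R * al * k%:R + b)) =
    (fun k => (Gamma (2%:R * al * k%:R + b))^-1 * (- m ^+ 2 * z ^+ 2) ^+ k).
  by apply/funext => k; rewrite mulrC.
have cML b : 1 <= b -> cvgn (series (fun k => (- m ^+ 2 * z ^+ 2) ^+ k /
    Gamma (2%:R * al * k%:R + b))).
  by move=> b1; rewrite MLE; exact: entire_invGamma.
have c0 := cML 1 (lexx _).
have c1 : cvgn (series (fun k => (- m ^+ 2 * z ^+ 2) ^+ k /
    Gamma (2%:R * al * k%:R + (al + 1)))) by apply: cML; rewrite lerDr ltW.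
have lF : (fun N => series F N.*2) @ \oo --> limn (series F).
  by apply: (cvg_comp _ _ cvg_double); exact: (entire_wave al m p q al0 z).
apply: (cvg_unique _ lF) => //.
rewrite (_ : (fun N => _) = (fun N =>
  p * series (fun k => (- m ^+ 2 * z ^+ 2) ^+ k / Gamma (2%:R * al * k%:R + 1)) N +
  q * (m * z * series (fun k => (- m ^+ 2 * z ^+ 2) ^+ k /
    Gamma (2%:R * al * k%:R + (al + 1))) N))).
  apply: cvgD; apply: cvgM; [exact: cvg_cst|exact: c0|exact: cvg_cst|].
  by apply: cvgM; [exact: cvg_cst|exact: c1].
apply/funext => N; rewrite series_evenodd /series/= !mulr_sumr; congr (_ + _).
  apply: eq_bigr => k _; rewrite /F /wave odd_double doubleK.
  rewrite (_ : al * k.*2%:R + 1 = 2%:R * al * k%:R + 1).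
    rewrite -mul2n exprM [in RHS]exprMn.
    by move: ((- m ^+ 2) ^+ k) ((z ^+ 2) ^+ k) => X Y; ring.
  by rewrite -mul2n natrM; ring.
apply: eq_bigr => k _; rewrite /F /wave /= odd_double /= uphalf_double.
rewrite (_ : al * k.*2.+1%:R + 1 = 2%:R * al * k%:R + (al + 1)).
  rewrite [z ^+ _.+1]exprS -mul2n exprM [in RHS]exprMn.
  by move: ((- m ^+ 2) ^+ k) ((z ^+ 2) ^+ k) => X Y; ring.
by rewrite -natr1 -mul2n natrM; ring.
Qed.

(** * Trigonometric polynomials of degree 2 *)

(** A family closed under d/dy that contains u^2; the double angle is written y + y to match the
    addition formulas. *)
Definition trig2 {R : realType} (a b c d e y : R) : R :=
  a + b * cos y + c * sin y + d * cos (y + y) + e * sin (y + y).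

Lemma is_derive_trig2 {R : realType} (a b c d e y : R) :
  is_derive y 1 (trig2 a b c d e) (trig2 0 c (- b) (2 * e) (- 2 * d) y).
Proof.
have d2 : is_derive y 1 (fun y : R => y + y) (1 + 1) by exact: is_deriveD.
have dc := @is_derive1_comp _ cos (fun y : R => y + y) y _ _ (is_derive_cos _) d2.
have ds := @is_derive1_comp _ sin (fun y : R => y + y) y _ _ (is_derive_sin _) d2.
have D := is_deriveD (is_deriveD (is_deriveD (is_deriveD (is_derive_cst a y 1)
  (is_deriveZ b (is_derive_cos y))) (is_deriveZ c (is_derive_sin y)))
  (is_deriveZ d dc)) (is_deriveZ e ds).
rewrite /trig2; apply: (is_derive_eq D).
by rewrite /GRing.scale /=; ring.
Qed.

Lemma derive1_trig2 {R : realType} (a b c d e : R) :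
  (trig2 a b c d e)^`()%classic = trig2 0 c (- b) (2 * e) (- 2 * d).
Proof.
by apply/funext => y; rewrite derive1E; have [_ ->] := is_derive_trig2 a b c d e y.
Qed.

Lemma n_derivable_trig2 {R : realType} (a b c d e y : R) (n : nat) :
  n_derivable n (trig2 a b c d e) y.
Proof.
move=> k _.
suff [a' [b' [c' [d' [e' ->]]]]] : exists a' b' c' d' e',
    (trig2 a b c d e)^`(k)%classic = trig2 a' b' c' d' e'.
  by have [] := is_derive_trig2 a' b' c' d' e' y.
elim: k => [|k [a' [b' [c' [d' [e' E]]]]]]; first by exists a, b, c, d, e.
by rewrite derive1nS E derive1_trig2; do 5 eexists.
Qed.

Lemma sqr_trig {R : realType} (C A B y : R) :
  (C + A * cos y - B * sin y) ^+ 2 =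
  trig2 (C ^+ 2 + (A ^+ 2 + B ^+ 2) / 2) (2 * C * A) (- (2 * C * B))
    ((A ^+ 2 - B ^+ 2) / 2) (- (A * B)) y.
Proof.
rewrite /trig2 cosD sinD; have := cos2Dsin2 y; move: (cos y) (sin y) => c s cs.
(* Once cos^2 + sin^2 is inserted in the constant term, the claim is a polynomial identity in c and
   s. *)
have -> : (C ^+ 2 + (A ^+ 2 + B ^+ 2) / 2) =
    (C ^+ 2 + (A ^+ 2 + B ^+ 2) / 2 * (c ^+ 2 + s ^+ 2)) by rewrite cs mulr1.
by field.
Qed.

(** * The dispersive equation *)

Theorem mainTheorem3 (R : realType) (alpha nu beta gamma C : R)
  (alpha_gt0 : 0 < alpha) (alpha_le1 : alpha <= 1)
  (h16 : 16%:R * nu - 4%:R * beta + gamma = 0)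
  (hmu : 2%:R * (nu - beta + gamma) != 0) :
  let mu : R := 2%:R * (nu - beta + gamma) in
  let mubar : R := C * mu in
  let u : R -> R -> R := fun x t =>
    C
    + mittag_leffler (2%:R * alpha) 1 (- mubar ^+ 2 * t `^ (2%:R * alpha))
      * cos x
    - mubar * t `^ alpha
      * mittag_leffler (2%:R * alpha) (alpha + 1)
          (- mubar ^+ 2 * t `^ (2%:R * alpha))
      * sin x in
  forall x t : R, 0 < t ->
    satisfies_dispersive_eq alpha nu beta gamma u x t.
Proof.
have gammaE : gamma = 4%:R * beta - 16%:R * nu by lra.
move=> mu mubar u x t t0.
have powR2 (s : R) : s `^ (2%:R * alpha) = (s `^ alpha) ^+ 2.
  by rewrite mulrC powRrM powR_mulrn ?powR_ge0.
have uE : (fun s => u x s) = (fun s => C + limn (pseries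
    (fun n => wave mubar (cos x) (- sin x) n / Gamma (alpha * n%:R + 1)) (s `^ alpha))).
  apply/funext => s; rewrite (limn_pseries_wave _ _ _ _ _ alpha_gt0) /u powR2.
  move: (mittag_leffler _ 1 _) (mittag_leffler _ (alpha + 1) _) => A B.
  ring.
(* The fractional derivative thus becomes [mubar] times the series for (-sin x, -cos x). *)
have wS : (fun n => wave mubar (cos x) (- sin x) n.+1 / Gamma (alpha * n%:R + 1)) =
    (fun n => mubar * (wave mubar (- sin x) (- cos x) n / Gamma (alpha * n%:R + 1))).
  by apply/funext => n; rewrite waveS mulrA.
have [|] := @frac_derive_pseries R alpha C (wave mubar (cos x) (- sin x)) t
    alpha_gt0 alpha_le1 t0 (entire_wave _ _ _ _ alpha_gt0).
  rewrite wS => z; rewrite (_ : pseries _ _ = series (fun n => mubar *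
    (wave mubar (- sin x) (- cos x) n / Gamma (alpha * n%:R + 1) * z ^+ n))).
    exact/is_cvg_seriesZ/entire_wave.
  by congr series; apply/funext => n; rewrite mulrA.
rewrite -uE wS limn_pseriesZ ?limn_pseries_wave//; last exact: entire_wave.
move=> fd fE.
pose A := mittag_leffler (2%:R * alpha) 1 (- mubar ^+ 2 * t `^ (2%:R * alpha)).
pose B := mubar * t `^ alpha * mittag_leffler (2%:R * alpha) (alpha + 1)
          (- mubar ^+ 2 * t `^ (2%:R * alpha)).
have u2E : (fun y => u y t ^+ 2) =
    trig2 (C ^+ 2 + (A ^+ 2 + B ^+ 2) / 2) (2 * C * A) (- (2 * C * B))
      ((A ^+ 2 - B ^+ 2) / 2) (- (A * B)).
  by apply/funext => y; rewrite -sqr_trig.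
split; rewrite ?u2E//; first exact: n_derivable_trig2.
rewrite fE !derive1nS derive1n0 !derive1_trig2 /trig2 -powR2 -/A -/B.
(* On the right, frequency 2 carries the factor 2(16 nu - 4 beta + gamma) = 0 and frequency 1 the
   factor nu - beta + gamma; both sides equal -C mu (A sin x + B cos x). *)
clearbody A B; rewrite /mubar /mu gammaE.
move: (cos x) (sin x) (cos (x + x)) (sin (x + x)) => c s c2 s2.
ring.
Qed.
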